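(* $\mathrm{MSO}[\le,\mathrm{Arb}_1]$ has the Crane Beach property: every language $L\subseteq A^*$ definable in $\mathrm{MSO}[\le,\mathrm{Arb}_1]$ that has a neutral letter is definable in $\mathrm{MSO}[\le]$, i.e. is regular.
   Context: A monadic predicate is $\mathbf{P}=(\mathbf{P}_n)_n$ with $\mathbf{P}_n\subseteq\{0,\ldots,n-1\}$ (arbitrary); $\mathrm{Arb}_1$ is the class of all of them. $L\in\mathrm{MSO}[\le,\mathrm{Arb}_1]$ means $L=\{u\in A^*\mid u,\mathbf{P}_1,\ldots,\mathbf{P}_\ell\models\varphi\}$ for an MSO sentence $\varphi$ over letter predicates, $\le$ and monadic predicate symbols $P_j$ (with $P_j(x)$ holding on a word of length $n$ iff $x\in(\mathbf{P}_j)_n$) and some monadic predicates $\mathbf{P}_j$. A letter $e\in A$ is neutral for $L$ if for all words $u,v$: $uv\in L\Leftrightarrow uev\in L$. *)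

(* Defs.v *)
From HB Require Import structures.
From mathcomp Require Import all_boot.

Set Implicit Arguments.
Unset Strict Implicit.
Unset Printing Implicit Defensive.

(** A language over [A] is an arbitrary predicate on [seq A]; a word [u] is the
    structure whose positions are ['I_(size u)], which is empty for [u = [::]]. *)
Definition language (A : finType) := seq A -> Prop.

Definition monadic_predicate := forall n : nat, {set 'I_n}.

Definition Arb1 : monadic_predicate -> Prop := fun=> True.
Definition no_predicate : monadic_predicate -> Prop := fun=> False.

(** MSO formulas over the alphabet [A] with [l] monadic predicate symbols,
    [n] free first-order variables and [m] free set variables. Variables are de
    Bruijn indices: [ord0] is the variable bound by the innermost quantifier of
    its sort. The remaining connectives and the universal quantifiers are the
    usual abbreviations. *)
Inductive formula (A : finType) (l n m : nat) : Type :=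
  | Letter of A & 'I_n
  | Le of 'I_n & 'I_n
  | Eq of 'I_n & 'I_n
  | In of 'I_n & 'I_m
  | Pred of 'I_l & 'I_n
  | Not of formula A l n m
  | And of formula A l n m & formula A l n m
  | Exists1 of formula A l n.+1 m
  | Exists2 of formula A l n m.+1.

Notation sentence A l := (formula A l 0 0).

Fixpoint sat (A : finType) (u : seq A) (l : nat) (P : 'I_l -> monadic_predicate)
    (n m : nat) (f : formula A l n m) :
    n.-tuple 'I_(size u) -> m.-tuple {set 'I_(size u)} -> bool :=
  match f with
  | Letter a x => fun s S => tnth (in_tuple u) (tnth s x) == a
  | Le x y => fun s S => tnth s x <= tnth s y
  | Eq x y => fun s S => tnth s x == tnth s y
  | In x X => fun s S => tnth s x \in tnth S X
  | Pred j x => fun s S => tnth s x \in P j (size u)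
  | Not g => fun s S => ~~ sat P g s S
  | And g h => fun s S => sat P g s S && sat P h s S
  | Exists1 g => fun s S =>
      [exists x : 'I_(size u), sat P g [tuple of x :: s] S]
  | Exists2 g => fun s S =>
      [exists X : {set 'I_(size u)}, sat P g s [tuple of X :: S]]
  end.
Arguments sat {A} u {l} P {n m} f s S.

Definition models (A : finType) (u : seq A) (l : nat)
    (P : 'I_l -> monadic_predicate) (f : sentence A l) : bool :=
  sat u P f [tuple] [tuple].

(** Definability in MSO[<=, C] for a class [C] of monadic predicates. For
    [C := no_predicate] this is MSO[<=], since then [l] must be 0. *)
Definition MSO_definable (C : monadic_predicate -> Prop) (A : finType)
    (L : language A) : Prop :=
  exists (l : nat) (P : 'I_l -> monadic_predicate) (f : sentence A l),
    (forall j, C (P j)) /\ (forall u : seq A, L u <-> models u P f).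

Definition neutral_letter (A : finType) (L : language A) (e : A) : Prop :=
  forall u v : seq A, L (u ++ v) <-> L (u ++ e :: v).

(** Recognizability by a complete deterministic finite automaton. *)
Definition regular (A : finType) (L : language A) : Prop :=
  exists (Q : finType) (q0 : Q) (delta : Q -> A -> Q) (F : {set Q}),
    forall u : seq A, L u <-> foldl delta q0 u \in F.

(* Main.v *)
(** Fix a sentence with monadic predicates. By composition there is a constant
    [k], depending neither on the length [n], nor on the cut [p], nor on the
    predicates, such that the words of length [p] fall into at most [k] classes
    as left parts of words of length [n]. A neutral letter allows any finite
    family of words, together with words separating their residuals, to be
    padded to a common [p] and [n]; hence [L] has at most [k] residuals and is
    regular by Myhill-Nerode, however wild the predicates are. *)
Require Import Defs.
From HB Require Import structures.
From mathcomp Require Import all_boot.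
From mathcomp Require Import boolp.

Set Implicit Arguments.
Unset Strict Implicit.
Unset Printing Implicit Defensive.

(** * Cutting words and valuations at a position *)

(** Both arguments have the full length [N], so that the result is evaluated over the same positions
    and predicates. Only the letters of [w] before [p] and those of [w'] from [p] on are used. *)
Definition splice (T : Type) (N p : nat) (w w' : N.-tuple T) : N.-tuple T :=
  [tuple if i < p then tnth w i else tnth w' i | i < N].

Definition splice_set (N p : nat) (X Y : {set 'I_N}) : {set 'I_N} :=
  [set i : 'I_N | i \in if i < p then X else Y].

Local Notation valuation N k := (k.-tuple {set 'I_N}).

Definition splice_sets (N p k : nat) (s s' : valuation N k) :
    valuation N k :=
  [tuple splice_set p (tnth s i) (tnth s' i) | i < k].

Lemma splice_sets_cons (N p k : nat) (X Y : {set 'I_N})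
    (s s' : valuation N k) :
  splice_sets p [tuple of X :: s] [tuple of Y :: s'] =
  [tuple of splice_set p X Y :: splice_sets p s s'].
Proof.
apply: eq_from_tnth => i; rewrite tnth_mktuple.
by case: (unliftP ord0 i) => [j|] ->; rewrite ?tnth0 // !tnthS tnth_mktuple.
Qed.

Lemma splice_setxx (N p : nat) (X : {set 'I_N}) : splice_set p X X = X.
Proof. by apply/setP => i; rewrite inE if_same. Qed.

(** A point lies on one side of the cut; the other side then sees [set0], which encodes a
    first-order variable placed elsewhere. *)
Lemma splice_set1 (N p : nat) (x : 'I_N) :
  [set x] = if x < p then splice_set p [set x] set0
            else splice_set p set0 [set x].
Proof.
apply/setP => i; case: ifP => xp; rewrite !inE; case: ifP => ip;
  rewrite ?inE //;
  by apply/eqP => ix; rewrite -ix ip in xp.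
Qed.

Lemma exists_splice_set (N p : nat) (X Y : {set 'I_N}) (F : pred 'I_N) :
  [exists i in splice_set p X Y, F i] =
  [exists i in X, (i < p) && F i] || [exists i in Y, (p <= i) && F i].
Proof.
apply/existsP/orP => [[i] | [] /existsP[i]].
- rewrite inE; case: ltnP => ip Hi; [left|right]; apply/existsP; exists i;
    by rewrite ip.
- by move=> /and3P[iX ip Fi]; exists i; rewrite inE ip iX.
- by move=> /and3P[iX ip Fi]; exists i; rewrite inE ltnNge ip iX.
Qed.

Lemma exists_in_set1 (T : finType) (x : T) (F : pred T) :
  [exists i in [set x], F i] = F x.
Proof.
apply/existsP/idP => [[i /andP[/set1P->]] //|Fx].
by exists x; rewrite set11.
Qed.

(** * Composition of truth values across a cut *)

(** First-order variables are interpreted by arbitrary sets, read as singletons,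
    so that a valuation can be restricted to either side of a cut. *)
Fixpoint set_sat (A : finType) (l N : nat) (P : 'I_l -> {set 'I_N})
    (w : N.-tuple A) (n m : nat) (f : formula A l n m) :
    valuation N n -> valuation N m -> bool :=
  match f with
  | Letter a x => fun s S => [exists i in tnth s x, tnth w i == a]
  | Le x y => fun s S =>
      [exists i in tnth s x, [exists j in tnth s y, i <= j]]
  | Eq x y => fun s S => [exists i in tnth s x, i \in tnth s y]
  | In x X => fun s S => [exists i in tnth s x, i \in tnth S X]
  | Pred j x => fun s S => [exists i in tnth s x, i \in P j]
  | Not g => fun s S => ~~ set_sat P w g s S
  | And g h => fun s S => set_sat P w g s S && set_sat P w h s S
  | Exists1 g => fun s S =>
      [exists x : 'I_N, set_sat P w g [tuple of [set x] :: s] S]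
  | Exists2 g => fun s S =>
      [exists X : {set 'I_N}, set_sat P w g s [tuple of X :: S]]
  end.

Lemma sat_set_sat (A : finType) (u : seq A) (l : nat)
    (P : 'I_l -> monadic_predicate) (n m : nat) (f : formula A l n m)
    (s : n.-tuple 'I_(size u)) (S : m.-tuple {set 'I_(size u)}) :
  sat u P f s S =
  set_sat (fun j => P j (size u)) (in_tuple u) f (map_tuple set1 s) S.
Proof.
elim: f s S => {n m} /=;
  try by move=> *; rewrite ?tnth_map !exists_in_set1 ?inE.
- by move=> n m g IH s S; rewrite IH.
- by move=> n m g IHg h IHh s S; rewrite IHg IHh.
- move=> n m g IH s S; apply: eq_existsb => x; rewrite IH.
  by congr (set_sat _ _ _ _ _); apply: val_inj.
- by move=> n m g IH s S; apply: eq_existsb => x; rewrite IH.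
Qed.

Lemma models_set_sat (A : finType) (l : nat) (P : 'I_l -> monadic_predicate)
    (f : sentence A l) (N : nat) (w : N.-tuple A) :
  models w P f = set_sat (fun j => P j N) w f [tuple] [tuple].
Proof.
(* Replacing [N] by [size u] gives both sides the same positions; the remaining tuples differ only
   in the proof of their length. *)
case: w => u su /=; have E := eqP su; case: N / E su => su.
rewrite /models sat_set_sat (tuple0 (map_tuple _ _)).
by have -> : Tuple su = in_tuple u by exact: val_inj.
Qed.

(* The whole point is that [T] is chosen before [N], [P] and [p]. *)
Lemma set_sat_splice (A : finType) (l n m : nat) (f : formula A l n m) :
  exists T : finType, forall (N : nat) (P : 'I_l -> {set 'I_N}) (p : nat),
  exists (tau : N.-tuple A -> valuation N n -> valuation N m -> T)
    (rho : T -> N.-tuple A -> valuation N n -> valuation N m -> bool),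
  forall w w' s s' S S',
    set_sat P (splice p w w') f (splice_sets p s s') (splice_sets p S S') =
    rho (tau w s S) w' s' S'.
Proof.
elim: f => {n m}.
(* The witness lies on one side of the cut, so one bit records what the left part contributes. All
   atoms but [Le] work in this way. *)
- move=> n m a x; exists bool => N P p.
  exists (fun w (s : valuation N n) (S : valuation N m) =>
    [exists i in tnth s x, (i < p) && (tnth w i == a)]).
  exists (fun t w (s : valuation N n) (S : valuation N m) =>
            t || [exists i in tnth s x, (p <= i) && (tnth w i == a)]).
  move=> w w' s s' S S' /=; rewrite tnth_mktuple exists_splice_set.
  by congr (_ || _); apply: eq_existsb => i; rewrite tnth_mktuple; case: ltnP.
(* Two bits: whether the order is witnessed inside the left part, and whether [x] has a point there.
   The second suffices when [y] is on the right; [x] on the right with [y] on the left is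
   impossible. *)
- move=> n m x y; exists (bool * bool)%type => N P p.
  exists (fun w (s : valuation N n) (S : valuation N m) =>
    ([exists i in tnth s x, (i < p) &&
       [exists j in tnth s y, (j < p) && (i <= j)]],
     [exists i in tnth s x, i < p])).
  exists (fun t w (s : valuation N n) (S : valuation N m) =>
    [|| t.1, t.2 && [exists j in tnth s y, p <= j]
    | [exists i in tnth s x, (p <= i) &&
        [exists j in tnth s y, (p <= j) && (i <= j)]]]).
  move=> w w' s s' S S' /=; rewrite !tnth_mktuple exists_splice_set.
  under eq_existsb => i do rewrite exists_splice_set.
  under [X in _ || X]eq_existsb => i do rewrite exists_splice_set.
  apply/idP/idP.
  + case/orP=> /exists_inP[i si /andP[ip]];
      case/orP=> /exists_inP[j sj /andP[jp ij]].
    * apply/or3P; apply: Or31; apply/exists_inP; exists i => //.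
      by rewrite ip; apply/exists_inP; exists j; rewrite // jp.
    * apply/or3P; apply: Or32; apply/andP; split; apply/exists_inP;
        by [exists i | exists j].
    * by have := leq_ltn_trans (leq_trans ip ij) jp; rewrite ltnn.
    * apply/or3P; apply: Or33; apply/exists_inP; exists i => //.
      by rewrite ip; apply/exists_inP; exists j; rewrite // jp.
  + case/or3P.
    * move=> /exists_inP[i si /andP[ip]] /exists_inP[j sj jp].
      apply/orP; left; apply/exists_inP; exists i => //; rewrite ip /=.
      by apply/orP; left; apply/exists_inP; exists j.
    * move=> /andP[/exists_inP[i si ip] /exists_inP[j sj jp]].
      apply/orP; left; apply/exists_inP; exists i => //; rewrite ip /=.
      apply/orP; right; apply/exists_inP; exists j => //.
      by rewrite jp (leq_trans (ltnW ip)).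
    * move=> /exists_inP[i si /andP[ip]] /exists_inP[j sj jp].
      apply/orP; right; apply/exists_inP; exists i => //; rewrite ip /=.
      by apply/orP; right; apply/exists_inP; exists j.
- move=> n m x y; exists bool => N P p.
  exists (fun w (s : valuation N n) (S : valuation N m) =>
    [exists i in tnth s x, (i < p) && (i \in tnth s y)]).
  exists (fun t w (s : valuation N n) (S : valuation N m) =>
            t || [exists i in tnth s x, (p <= i) && (i \in tnth s y)]).
  move=> w w' s s' S S' /=; rewrite !tnth_mktuple exists_splice_set.
  by congr (_ || _); apply: eq_existsb => i; rewrite inE; case: ltnP.
- move=> n m x X; exists bool => N P p.
  exists (fun w (s : valuation N n) (S : valuation N m) =>
    [exists i in tnth s x, (i < p) && (i \in tnth S X)]).
  exists (fun t w (s : valuation N n) (S : valuation N m) =>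
            t || [exists i in tnth s x, (p <= i) && (i \in tnth S X)]).
  move=> w w' s s' S S' /=; rewrite !tnth_mktuple exists_splice_set.
  by congr (_ || _); apply: eq_existsb => i; rewrite inE; case: ltnP.
- move=> n m j x; exists bool => N P p.
  exists (fun w (s : valuation N n) (S : valuation N m) =>
    [exists i in tnth s x, (i < p) && (i \in P j)]).
  exists (fun t w (s : valuation N n) (S : valuation N m) =>
            t || [exists i in tnth s x, (p <= i) && (i \in P j)]).
  by move=> w w' s s' S S' /=; rewrite !tnth_mktuple exists_splice_set.
- move=> n m g [T HT]; exists T => N P p; have [tau [rho H]] := HT N P p.
  exists tau, (fun t w (s : valuation N n) (S : valuation N m) =>
    ~~ rho t w s S).
  by move=> w w' s s' S S' /=; rewrite H.
- move=> n m g [T HT] h [U HU]; exists (T * U)%type => N P p.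
  have [tau [rho H]] := HT N P p; have [tau' [rho' H']] := HU N P p.
  exists (fun w (s : valuation N n) (S : valuation N m) =>
    (tau w s S, tau' w s S)).
  exists (fun t w (s : valuation N n) (S : valuation N m) =>
    rho t.1 w s S && rho' t.2 w s S).
  by move=> w w' s s' S S' /=; rewrite H H'.
(* For a point on the left, the right part sees [set0] and picks among the types that the left part
   realizes. For a point on the right, the left part has the single type given by [set0]. *)
- move=> n m g [T HT]; exists ({set T} * T)%type => N P p.
  have [tau [rho H]] := HT N P p.
  exists (fun w (s : valuation N n) (S : valuation N m) =>
    ([set tau w [tuple of [set x] :: s] S | x : 'I_N & x < p],
     tau w [tuple of set0 :: s] S)).
  exists (fun (t : {set T} * T) w (s : valuation N n) (S : valuation N m) =>
    [exists t' in t.1, rho t' w [tuple of set0 :: s] S] ||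
    [exists x : 'I_N, (p <= x) && rho t.2 w [tuple of [set x] :: s] S]).
  move=> w w' s s' S S' /=.
  have Hx x : set_sat P (splice p w w') g
      [tuple of [set x] :: splice_sets p s s'] (splice_sets p S S') =
    if x < p then
      rho (tau w [tuple of [set x] :: s] S) w' [tuple of set0 :: s'] S'
    else rho (tau w [tuple of set0 :: s] S) w' [tuple of [set x] :: s'] S'.
    have := splice_set1 p x.
    by case: ifP => _ E; rewrite -H splice_sets_cons -E.
  apply/existsP/orP => [[x]|[]].
  + rewrite Hx; case: ltnP => xp Hr; [left|right]; last first.
      by apply/existsP; exists x; rewrite xp.
    apply/exists_inP; exists (tau w [tuple of [set x] :: s] S) => //.
    by apply/imsetP; exists x; rewrite ?inE.
  + case/exists_inP=> _ /imsetP[x xp ->] Hr; exists x; rewrite Hx.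
    by rewrite inE in xp; rewrite xp.
  + by case/existsP=> x /andP[xp Hr]; exists x; rewrite Hx ltnNge xp.
(* A set splits into two independent halves, so the left part offers all the types it realizes and
   the right half is chosen separately. *)
- move=> n m g [T HT]; exists {set T} => N P p.
  have [tau [rho H]] := HT N P p.
  exists (fun w (s : valuation N n) (S : valuation N m) =>
    [set tau w s [tuple of X :: S] | X : {set 'I_N}]).
  exists (fun (t : {set T}) w (s : valuation N n) (S : valuation N m) =>
    [exists t' in t, [exists X : {set 'I_N}, rho t' w s [tuple of X :: S]]]).
  move=> w w' s s' S S' /=; apply/existsP/exists_inP => [[X HX]|].
  + exists (tau w s [tuple of X :: S]); first exact: imset_f.
    by apply/existsP; exists X; rewrite -H splice_sets_cons splice_setxx.
  + case=> _ /imsetP[X _ ->] /existsP[Y]; rewrite -H splice_sets_cons => Hr.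
    by exists (splice_set p X Y).
Qed.

(** * Myhill-Nerode from a bound on inequivalent words *)

Definition right_equiv (A : finType) (L : pred (seq A)) (u u' : seq A) : Prop :=
  forall v, L (u ++ v) = L (u' ++ v).

Definition inequivalent (A : finType) (L : pred (seq A)) (us : seq (seq A)) :=
  uniq us /\ {in us &, forall u u', right_equiv L u u' -> u = u'}.

(** An inequivalent family of maximal size represents every word up to [right_equiv]. Its members
    serve as states, and the transitions are sound because [right_equiv] is a right congruence. *)
Lemma myhill_nerode (A : finType) (L : pred (seq A)) (k : nat) :
  (forall us, inequivalent L us -> size us <= k) -> regular L.
Proof.
move=> bound.
pose has_size m := `[< exists2 us, inequivalent L us & size us = m >].
have ex0 : exists m, has_size m by exists 0; apply/asboolP; exists [::].
have ub m : has_size m -> m <= k by case/asboolP=> us /bound + <-.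
case: (ex_maxnP ex0 ub) => m /asboolP[us [us_uniq us_ineq] sz_us] max_m.
(* By maximality: a word without a representative could be added to the family. *)
have rep u : exists u', (u' \in us) /\ right_equiv L u' u.
  apply: contrapT => none.
  suff: m.+1 <= m by rewrite ltnn.
  apply: max_m; apply/asboolP; exists (u :: us); last by rewrite /= sz_us.
  split=> /= [|u1 u2].
    by rewrite us_uniq andbT; apply/negP => uus; apply: none; exists u.
  rewrite !inE => /predU1P[->|u1s] /predU1P[->|u2s] E //; last exact: us_ineq.
    by case: none; exists u2; split=> // v; rewrite E.
  by case: none; exists u1.
have /choice[r r_spec] := rep.
pose q u : seq_sub us := SeqSub (r_spec u).1.
have qE u u' : right_equiv L u u' -> q u = q u'.
  move=> E; apply: val_inj; apply: us_ineq; rewrite ?ssvalP //= => v.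
  by rewrite (r_spec u).2 (r_spec u').2.
exists (seq_sub us), (q [::]), (fun x a => q (rcons (ssval x) a)).
exists [set x : seq_sub us | L (ssval x)] => u.
(* The state reached is the representative of the word read; testing the empty suffix then settles
   acceptance. *)
suff -> : foldl (fun x a => q (rcons (ssval x) a)) (q [::]) u = q u.
  by rewrite inE; have := (r_spec u).2 [::]; rewrite !cats0 => ->.
elim/last_ind: u => // u a IH; rewrite foldl_rcons IH; apply: qE => v.
by rewrite /= !cat_rcons (r_spec u).2.
Qed.

(** * Bounding the residuals by padding with a neutral letter *)

Lemma neutral_nseq (A : finType) (L : pred (seq A)) (e : A) (k : nat)
    (u v : seq A) :
  neutral_letter (fun w => L w) e -> L (u ++ nseq k e ++ v) = L (u ++ v).
Proof.
by move=> eN; elim: k => //= k <-; apply/idP/idP; apply eN.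
Qed.

(** Each word of the family is mapped to the type in [T] of its padded left part. Words of equal
    type agree on every chosen suffix, so the map is injective and [#|T|] is a bound. *)
Lemma inequivalent_size (A : finType) (l : nat) (P : 'I_l -> monadic_predicate)
    (f : sentence A l) (e : A) :
  neutral_letter (fun u => models u P f) e ->
  exists k, forall us, inequivalent (fun u => models u P f) us -> size us <= k.
Proof.
move=> eN; have [T HT] := set_sat_splice f; exists #|T| => us [us_uniq us_ineq].
pose L u := models u P f.
(* One suffix per pair decides equivalence; an equivalent pair gets the empty word as a default. *)
have /choice[sep sepP] : forall uu : seq A * seq A, exists v,
    L (uu.1 ++ v) = L (uu.2 ++ v) -> right_equiv L uu.1 uu.2.
  move=> uu; have [E|/existsNP[v Ev]] := pselect (right_equiv L uu.1 uu.2).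
    by exists [::].
  by exists v.
(* With these maxima a single length [p + r], hence a single interpretation of the predicates,
   serves all pairs. *)
pose p := \max_(u <- us) size u.
pose r := \max_(u <- us) \max_(u' <- us) size (sep (u, u')).
have [tau [rho H]] := HT (p + r) (fun j => P j (p + r)) p.
(* The word [u] starts at 0 and [v] at the cut [p]; what lies across the cut is filler. The default
   of [insubd] is not reached when [size u <= p] and [size v <= r]. *)
pose left u := insubd [tuple of nseq (p + r) e] (u ++ nseq (p + r - size u) e).
pose right v := insubd [tuple of nseq (p + r) e]
  (nseq p e ++ v ++ nseq (r - size v) e).
have LE u v : size u <= p -> size v <= r ->
    L (u ++ v) = rho (tau (left u) [tuple] [tuple]) (right v) [tuple] [tuple].
  move=> up vr.
  have vl : val (left u) = u ++ nseq (p + r - size u) e.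
    rewrite /left val_insubd size_cat size_nseq subnKC ?eqxx //.
    exact: leq_trans up (leq_addr _ _).
  have vright : val (right v) = nseq p e ++ v ++ nseq (r - size v) e.
    by rewrite /right val_insubd !size_cat !size_nseq subnKC ?eqxx.
  rewrite -H !(tuple0 (splice_sets _ _ _)) -models_set_sat.
  (* The splice is [u] padded to length [p] followed by [v] padded to length [r]; both blocks of [e]
     can be erased by neutrality. *)
  have -> : splice p (left u) (right v) =
     u ++ nseq (p - size u) e ++ v ++ nseq (r - size v) e :> seq A.
    apply: (@eq_from_nth _ e) => [|i].
      by rewrite size_tuple !size_cat !size_nseq addnA !subnKC.
    rewrite size_tuple => ilt; pose i' := Ordinal ilt.
    rewrite -[i]/(val i') -tnth_nth tnth_mktuple !(tnth_nth e) vl vright /=.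
    rewrite !nth_cat !size_nseq !nth_nseq.
    have [ip|pi] := ltnP i p.
      case: ltnP => // ui.
      by rewrite [_ < p - _]ltn_sub2r ?(leq_ltn_trans ui ip) ?if_same.
    rewrite [i < size u]ltnNge (leq_trans up pi) /=.
    rewrite [_ < p - _]ltnNge leq_sub2r //=.
    by rewrite subnBA // subnK // (leq_trans up).
  rewrite -/(L _) (@neutral_nseq _ L) // catA -[nseq (r - _) e]cats0.
  by rewrite (@neutral_nseq _ L) // cats0.
rewrite -(size_map (fun u => tau (left u) [tuple] [tuple])).
rewrite -(card_uniqP _) ?max_card // map_inj_in_uniq //.
move=> u u' us_u us_u' E; apply: us_ineq => //; apply: (sepP (u, u')) => /=.
have le_p v : v \in us -> size v <= p by move=> vs; exact: leq_bigmax_seq.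
have le_r : size (sep (u, u')) <= r.
  apply: leq_trans (leq_bigmax_seq _ us_u isT).
  exact: (leq_bigmax_seq (F := fun v => size (sep (u, v))) u' us_u' isT).
by rewrite !LE ?le_p // E.
Qed.

(** * Derived connectives and quantifiers of MSO *)

Definition no_predicates (j : 'I_0) : monadic_predicate := fun n => set0.

Section Abbreviations.

Variable (A : finType).

(** The universal form makes it true on the empty word as well. *)
Definition Top n m : formula A 0 n m :=
  Not (Exists1 (Not (Eq _ _ _ ord0 ord0))).

Definition Forall1 n m (f : formula A 0 n.+1 m) : formula A 0 n m :=
  Not (Exists1 (Not f)).

Definition Imp n m (f g : formula A 0 n m) : formula A 0 n m :=
  Not (And f (Not g)).

Definition AndAll n m (T : finType) (F : T -> formula A 0 n m) :
    formula A 0 n m :=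
  foldr (fun t f => And (F t) f) (Top n m) (enum T).

(** Closes all set variables at once, for a number of them that varies with the automaton. *)
Fixpoint Exists2s n m : formula A 0 n m -> formula A 0 n 0 :=
  match m with
  | 0 => id
  | m'.+1 => fun f => Exists2s (Exists2 f)
  end.

Variable (u : seq A).
Local Notation sat f s S := (sat u no_predicates f s S).

Lemma sat_Top n m (s : n.-tuple 'I_(size u)) (S : m.-tuple {set 'I_(size u)}) :
  sat (Top n m) s S.
Proof. by apply/existsPn => x /=; rewrite negbK. Qed.

Lemma sat_Forall1 n m (f : formula A 0 n.+1 m)
    (s : n.-tuple 'I_(size u)) (S : m.-tuple {set 'I_(size u)}) :
  reflect (forall x, sat f [tuple of x :: s] S) (sat (Forall1 f) s S).
Proof.
apply: (iffP existsPn) => H x; first exact/negPn/H.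
by rewrite /= negbK; exact: H.
Qed.

Lemma sat_And n m (f g : formula A 0 n m)
    (s : n.-tuple 'I_(size u)) (S : m.-tuple {set 'I_(size u)}) :
  reflect (sat f s S /\ sat g s S) (sat (And f g) s S).
Proof. exact: andP. Qed.

Lemma sat_Imp n m (f g : formula A 0 n m)
    (s : n.-tuple 'I_(size u)) (S : m.-tuple {set 'I_(size u)}) :
  reflect (sat f s S -> sat g s S) (sat (Imp f g) s S).
Proof. by rewrite /= negb_and negbK -implybE; exact: implyP. Qed.

Lemma sat_AndAll n m (T : finType) (F : T -> formula A 0 n m)
    (s : n.-tuple 'I_(size u)) (S : m.-tuple {set 'I_(size u)}) :
  reflect (forall t, sat (F t) s S) (sat (AndAll F) s S).
Proof.
have -> : sat (AndAll F) s S = all (fun t => sat (F t) s S) (enum T).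
  rewrite /AndAll; elim: (enum T) => [|t ts IH]; first exact: sat_Top.
  by rewrite /= IH.
by apply: (iffP allP) => H t; [apply: H; rewrite mem_enum | move=> _].
Qed.

Lemma sat_Exists2s n m (f : formula A 0 n m) (s : n.-tuple 'I_(size u)) :
  sat (Exists2s f) s [tuple] <-> exists S, sat f s S.
Proof.
elim: m f => [|m IH] f /=.
  by split=> [H|[S]]; [exists [tuple] | rewrite (tuple0 S)].
rewrite IH; split=> [[S /existsP[X H]]|[S H]];
  first by exists [tuple of X :: S].
by exists (behead_tuple S); apply/existsP; exists (thead S); rewrite -tuple_eta.
Qed.

End Abbreviations.

(** * Describing the run of an automaton in MSO *)

Section Automaton.

Variables (A Q : finType) (q0 : Q) (delta : Q -> A -> Q) (F : {set Q}).

Let state n (q : Q) (x : 'I_n) : formula A 0 n #|Q| := In _ _ x (enum_rank q).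
Let x1 : 'I_1 := ord0.
(** Under two quantifiers, [x2] is bound by the outer one and [y2] by the inner one. *)
Let y2 : 'I_2 := ord0.
Let x2 : 'I_2 := lift ord0 ord0.

(** A position is labelled by the state reached after reading its letter, hence [delta q0 a] at the
    first one. *)
Definition first_clause : formula A 0 0 #|Q| :=
  Forall1 (Imp (Forall1 (Le _ _ _ x2 y2))
    (AndAll (fun a => Imp (Letter _ _ a x1) (state (delta q0 a) x1)))).

(** Successor by means of the order: [y2] is the least position beyond [x2]. The third quantifier
    shifts both indices by [lift ord0]. *)
Definition succ_formula : formula A 0 2 #|Q| :=
  And (Not (Le _ _ _ y2 x2))
    (Forall1 (Imp (Not (Le _ _ _ ord0 (lift ord0 x2)))
                  (Le _ _ _ (lift ord0 y2) ord0))).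

Definition next_clause : formula A 0 0 #|Q| :=
  Forall1 (Forall1 (Imp succ_formula
    (AndAll (fun a => AndAll (fun q =>
       Imp (And (state q x2) (Letter _ _ a y2)) (state (delta q a) y2)))))).

Definition last_clause : formula A 0 0 #|Q| :=
  Forall1 (Imp (Forall1 (Le _ _ _ y2 x2))
    (AndAll (fun q : Q => if q \in F then Not (state q x1) else Top A _ _))).

(* On the empty word the other three clauses hold vacuously. *)
Definition empty_clause : formula A 0 0 #|Q| :=
  if q0 \in F then Exists1 (Eq _ _ _ x1 x1) else Top A _ _.

(* The sets need not be disjoint: as they contain the run of the automaton, it
   is enough that the last position be labelled by no accepting state. *)
Definition reject_formula : sentence A 0 :=
  Exists2s (And empty_clause
    (And first_clause (And next_clause last_clause))).

Section Run.

Variable (u : seq A) (S : #|Q|.-tuple {set 'I_(size u)}).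
Local Notation sat f s := (sat u no_predicates f s S).
Local Notation letter := (tnth (in_tuple u)).
Local Notation label q := (tnth S (enum_rank q)).

Lemma sat_first_clause :
  sat first_clause [tuple] <->
  forall x : 'I_(size u), x = 0 :> nat -> x \in label (delta q0 (letter x)).
Proof.
split=> [/sat_Forall1 H x x0|H].
  have /sat_Imp Hx := H x.
  have /Hx/sat_AndAll/(_ (letter x))/sat_Imp :
      sat (Forall1 (Le _ _ _ x2 y2)) [tuple x].
    by apply/sat_Forall1 => y /=; rewrite [val x]x0.
  by apply=> /=.
apply/sat_Forall1 => x; apply/sat_Imp => /sat_Forall1 Hx.
apply/sat_AndAll => a; apply/sat_Imp => /eqP <-; apply: H.
by have := Hx (Ordinal (leq_ltn_trans (leq0n x) (ltn_ord x)));
  rewrite /= leqn0 => /eqP.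
Qed.

Lemma sat_succ (x y : 'I_(size u)) :
  reflect (y = x.+1 :> nat) (sat succ_formula [tuple y; x]).
Proof.
apply: (iffP (sat_And _ _ _ _)) => [[xy /sat_Forall1 H]|yx].
  have {}xy : x < y by rewrite ltnNge.
  apply/eqP; rewrite eqn_leq xy andbT.
  (* The bound variable is instantiated at [x.+1], a position because [y] lies beyond [x]. *)
  have xs : x.+1 < size u by exact: leq_ltn_trans xy (ltn_ord y).
  by have /sat_Imp := H (Ordinal xs); apply; rewrite /= -ltnNge.
split; first by rewrite /= -ltnNge; rewrite [val y]yx.
by apply/sat_Forall1 => z; apply/sat_Imp; rewrite /= -ltnNge [val y]yx.
Qed.

Lemma sat_next_clause :
  sat next_clause [tuple] <->
  forall (x y : 'I_(size u)) q, y = x.+1 :> nat -> x \in label q ->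
    y \in label (delta q (letter y)).
Proof.
split=> [/sat_Forall1 H x y q yx xq|H].
  have /sat_Forall1/(_ y)/sat_Imp H1 := H x.
  have /sat_AndAll/(_ (letter y))/sat_AndAll/(_ q)/sat_Imp :=
    H1 (introT (sat_succ x y) yx).
  by apply; apply/andP; split=> /=.
apply/sat_Forall1 => x; apply/sat_Forall1 => y; apply/sat_Imp => /sat_succ yx.
apply/sat_AndAll => a; apply/sat_AndAll => q.
apply/sat_Imp => /andP[xq /eqP <-].
exact: H yx xq.
Qed.

Lemma sat_last_clause :
  sat last_clause [tuple] <->
  forall (x : 'I_(size u)) q, x.+1 = size u -> q \in F -> x \notin label q.
Proof.
split=> [/sat_Forall1 H x q xl qF|H].
  have /sat_Imp H1 := H x.
  have : sat (Forall1 (Le _ _ _ y2 x2)) [tuple x].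
    by apply/sat_Forall1 => y /=; rewrite -ltnS [X in _ < X]xl.
  by move/H1/sat_AndAll/(_ q); rewrite qF.
apply/sat_Forall1 => x; apply/sat_Imp => /sat_Forall1 Hx.
apply/sat_AndAll => q; case: ifP => [qF|_]; last exact: sat_Top.
apply: H => //; apply/eqP; rewrite eqn_leq ltn_ord.
have sz : (size u).-1 < size u
  by rewrite ltn_predL (leq_ltn_trans _ (ltn_ord x)).
by have := Hx (Ordinal sz);
  rewrite /= -(leq_add2r 1) !addn1 prednK // (leq_ltn_trans _ sz).
Qed.

Lemma sat_empty_clause :
  sat empty_clause [tuple] <-> (q0 \in F -> 0 < size u).
Proof.
rewrite /empty_clause; case: ifP => q0F; last first.
  by split=> // _; exact: sat_Top.
split=> [/existsP[x _] _|/(_ isT) u0]; first exact: leq_ltn_trans (ltn_ord x).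
by apply/existsP; exists (Ordinal u0); exact: eqxx.
Qed.

End Run.

(** Sets satisfying the clauses contain the run, which therefore ends outside [F]; conversely, a
    rejecting run supplies the sets. *)
Lemma models_reject_formula (u : seq A) :
  models u no_predicates reject_formula = (foldl delta q0 u \notin F).
Proof.
pose run i := foldl delta q0 (take i u).
have runS (x : 'I_(size u)) : run x.+1 = delta (run x) (tnth (in_tuple u) x).
  rewrite (tnth_nth (tnth (in_tuple u) x)) /run.
  by rewrite (take_nth (tnth (in_tuple u) x)) // foldl_rcons.
have run_size : foldl delta q0 u = run (size u) by rewrite /run take_size.
have run0 : run 0 = q0 by rewrite /run take0.
rewrite /models; apply/idP/idP => [/sat_Exists2s[S]|rej].
  move=> /sat_And[/sat_empty_clause Hempty] /sat_And[/sat_first_clause Hfirst].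
  move=> /sat_And[/sat_next_clause Hnext /sat_last_clause Hlast].
  have Hrun i (x : 'I_(size u)) : x = i :> nat ->
      x \in tnth S (enum_rank (run x.+1)).
    elim: i x => [|i IH] x xi.
      by rewrite runS [in run _]xi run0; exact: Hfirst.
    have ilt : i < size u by rewrite ltnW // -xi ltn_ord.
    rewrite runS; apply: (Hnext (Ordinal ilt)) => //.
    by have := IH (Ordinal ilt) erefl; rewrite /= xi.
  (* The empty word has no last position, so [empty_clause] has to exclude an accepting [q0]. *)
  apply/negP; rewrite run_size; case: (posnP (size u)) => [u0|u0].
    by rewrite u0 run0 => /Hempty; rewrite u0.
  have sz : (size u).-1 < size u by rewrite ltn_predL.
  move=> accF; have := Hlast (Ordinal sz) _ (prednK u0) accF.
  by have := Hrun _ (Ordinal sz) erefl; rewrite /= prednK // => ->.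
apply/sat_Exists2s.
(* The labelling by the run itself; the index [x.+1] counts the letter at [x] as read. *)
exists [tuple [set x : 'I_(size u) | enum_rank (run x.+1) == i] | i < #|Q|].
apply/and4P; split.
- apply/sat_empty_clause => q0F; rewrite lt0n; apply: contraNneq rej => u0.
  by rewrite run_size u0 run0.
- apply/sat_first_clause => x x0.
  by rewrite tnth_mktuple inE runS [in run _]x0 run0.
- apply/sat_next_clause => x y q yx.
  rewrite !tnth_mktuple !inE => /eqP/enum_rank_inj <-.
  by rewrite (runS y) yx.
- apply/sat_last_clause => x q xl qF.
  rewrite tnth_mktuple inE (inj_eq enum_rank_inj) xl -run_size.
  by apply: contraNneq rej => ->.
Qed.

End Automaton.

Lemma regular_MSO (A : finType) (L : language A) :
  regular L -> MSO_definable no_predicate L.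
Proof.
case=> [Q [q0 [delta [F LE]]]].
(* Acceptance is expressed as the negation of rejection. *)
exists 0, no_predicates, (Not (reject_formula q0 delta F)).
split; first by case.
move=> u; rewrite LE.
change (foldl delta q0 u \in F <->
  ~~ models u no_predicates (reject_formula q0 delta F)).
by rewrite models_reject_formula negbK.
Qed.

(** * Neutral letters force regularity *)

Theorem mainTheorem12 (A : finType) (L : language A)
    (hL : MSO_definable Arb1 L)
    (he : exists e : A, neutral_letter L e) :
  MSO_definable no_predicate L /\ regular L.
Proof.
suff regL : regular L by split=> //; exact: regular_MSO.
have [l [P [f [_ LE]]]] := hL; have [e eN] := he.
have [|k /myhill_nerode] := @inequivalent_size _ _ P f e.
  by move=> u v; rewrite -!LE; exact: eN.
by case=> [Q [q0 [delta [F H]]]]; exists Q, q0, delta, F => u; rewrite LE.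
Qed.
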